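(* If $(t_k)$ and $(\tau_k)$, $k=0,1,2,\ldots$, are a binomial-transform pair of the first kind, then so are the sequences \[ a_k=-\frac{1}{k+1}\sum_{j=1}^k\tau_{j-1}\quad\text{and}\quad \alpha_k=\frac{1}{k+1}\sum_{j=1}^k t_{j-1},\qquad k=0,1,2,\ldots. \]
   Context: Two sequences $(t_k)_{k\ge0}$ and $(\tau_k)_{k\ge0}$ of complex numbers form a binomial-transform pair of the first kind if $\tau_n=\sum_{k=0}^n(-1)^k\binom nk t_k$ for every non-negative integer $n$. An empty sum equals $0$. *)

(* Defs.v *)
From HB Require Import structures.
From mathcomp Require Import all_boot all_order all_algebra.
From mathcomp Require Import reals.
From mathcomp Require Import complex.

Set Implicit Arguments.
Unset Strict Implicit.
Unset Printing Implicit Defensive.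

Import Order.TTheory GRing.Theory Num.Theory.
Local Open Scope ring_scope.
Local Open Scope complex_scope.

(* The complex numbers are R[i] for R : realType, a complete Archimedean
   ordered field. *)
Definition binomial_pair_first_kind (R : realType) (t tau : nat -> R[i]) :
  Prop :=
  forall n : nat, tau n = \sum_(0 <= k < n.+1) (-1) ^+ k * 'C(n, k)%:R * t k.

(* Main.v *)
(* Write B f n = \sum_(k <= n) (-1)^k C(n, k) f k.  Pascal's rule reads
   B f (n+1) = B f n - B (f \o succn) n, from which B is an involution by
   induction.  With S the partial sums of tau, two uses of the same rule give
   B (S \o predn) (n+2) = B (S \o predn) (n+1) + B tau n, hence
   B (S \o predn) (n+1) is the sum of the first n terms of t = B tau; absorbing
   n+1 into the binomial coefficients turns this into the claim. *)
Require Import Defs.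
From HB Require Import structures.
From mathcomp Require Import all_boot all_order all_algebra.
From mathcomp Require Import reals.
From mathcomp Require Import complex.

Set Implicit Arguments.
Unset Strict Implicit.
Unset Printing Implicit Defensive.

Import Order.TTheory GRing.Theory Num.Theory.
Local Open Scope ring_scope.
Local Open Scope complex_scope.

Definition binomial_transform (R : pzRingType) (f : nat -> R) (n : nat) : R :=
  \sum_(0 <= k < n.+1) (-1) ^+ k * 'C(n, k)%:R * f k.

Lemma eq_binomial_transform (R : pzRingType) (f g : nat -> R) :
  f =1 g -> binomial_transform f =1 binomial_transform g.
Proof. by move=> fg n; apply: eq_bigr => k _; rewrite fg. Qed.

Lemma binomial_transformB (R : pzRingType) (f g : nat -> R) n :
  binomial_transform (fun k => f k - g k) n =
  binomial_transform f n - binomial_transform g n.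
Proof. by rewrite -sumrB; apply: eq_bigr => k _; rewrite mulrBr. Qed.

Lemma binomial_transformS (R : pzRingType) (f : nat -> R) n :
  binomial_transform f n.+1 =
  binomial_transform f n - binomial_transform (f \o succn) n.
Proof.
(* The sum is padded with the index [n.+1], where the binomial coefficient vanishes, so that both
   sides have the same range. *)
have -> : binomial_transform f n =
    \sum_(0 <= k < n.+2) (-1) ^+ k * 'C(n, k)%:R * f k.
  by rewrite [RHS]big_nat_recr //= bin_small // mulr0 mul0r addr0.
rewrite /binomial_transform !(big_nat_recl n.+1) //= !bin0 -addrA.
congr (_ + _).
rewrite -sumrB; apply: eq_bigr => k _.
by rewrite binS natrD mulrDr mulrDl [in X in _ + X]exprS !mulN1r !mulNr.
Qed.

(** Applying Pascal's rule to the outer and then to the inner transform cancels all but the double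
    transform of [f \o succn] at [n]; hence the induction is on [n] for all [f]. *)
Lemma binomial_transformK (R : pzRingType) (f : nat -> R) :
  binomial_transform (binomial_transform f) =1 f.
Proof.
move=> n; elim: n f => [|n IHn] f.
  by rewrite /binomial_transform !big_nat1 !mul1r.
rewrite binomial_transformS (eq_binomial_transform (binomial_transformS f)).
by rewrite binomial_transformB opprB addrC subrK IHn.
Qed.

Lemma binomial_transform_sum (R : pzRingType) (f : nat -> R) n :
  binomial_transform (fun k => \sum_(0 <= j < k.-1) f j) n.+1 =
  \sum_(0 <= j < n) binomial_transform f j.
Proof.
elim: n => [|n IHn].
  (* Only [k = 0] and [k = 1] occur, and [k.-1 = 0] for both. *)
  rewrite big_geq // /binomial_transform big1_seq // => -[|[|k]];
    by rewrite mem_index_iota // [X in _ * X]big_geq ?mulr0.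
rewrite big_nat_recr //= -IHn binomial_transformS; congr (_ + _).
(* What remains is the transform of the difference of consecutive partial sums, which is [f]. *)
rewrite binomial_transformS opprB -binomial_transformB.
by apply: eq_binomial_transform => k /=;
  rewrite big_nat_recr //= addrAC addrN add0r.
Qed.

Theorem theorem18 (R : realType) (t tau : nat -> R[i])
  (h : binomial_pair_first_kind t tau) :
  binomial_pair_first_kind
    (fun k : nat => - (1 / k.+1%:R) * \sum_(1 <= j < k.+1) tau (j - 1)%N)
    (fun k : nat => 1 / k.+1%:R * \sum_(1 <= j < k.+1) t (j - 1)%N).
Proof.
have tE : binomial_transform tau =1 t.
  by move=> n; rewrite (eq_binomial_transform h) binomial_transformK.
have shift (f : nat -> R[i]) k :
    \sum_(1 <= j < k.+1) f (j - 1)%N = \sum_(0 <= j < k) f j.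
  by rewrite big_add1; apply: eq_bigr => j _; rewrite subn1.
move=> n; rewrite shift.
have nz m : m.+1%:R != 0 :> R[i] by rewrite pnatr_eq0.
apply: (mulfI (nz n)); rewrite mulrA mul1r divff // mul1r mulr_sumr.
rewrite -(eq_bigr _ (fun j _ => tE j)) -binomial_transform_sum.
(* The term at [0] is an empty sum; reindexing the rest by [k.+1] turns [k.-1] into [k], and the
   extra factor -1 is the minus sign of the claim. *)
rewrite /binomial_transform big_nat_recl //=.
rewrite [X in _ * X + _]big_geq // mulr0 add0r.
apply: eq_bigr => k _; rewrite shift.
have absorb : n.+1%:R * 'C(n, k)%:R / k.+1%:R = 'C(n.+1, k.+1)%:R :> R[i].
  by rewrite -natrM mul_bin_diag natrM mulrAC divff // mul1r.
rewrite -absorb exprS mulN1r mul1r !mulNr !mulrN !mulrA.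
by rewrite [n.+1%:R * _]mulrC.
Qed.
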